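(* Let $n\ge 1$, $1\le r\le n$, let $F:\mathbb{R}^{n\times n}\to\mathbb{R}$ be twice continuously differentiable, $\mu_F$-strongly convex and $L_F$-smooth, and let $f(X)=F(XX^T)$ for $X\in\mathbb{R}^{n\times r}$, with $\min_{\mathbb{R}^{n\times r}}f>-\infty$. Let $\alpha,\beta\ge0$, $\sigma>0$ and $$h_G(X)=\frac{\alpha}{4}\|X\|^4+\frac{\beta}{4}\|X^TX\|^2+\frac{\sigma}{2}\|X\|^2,\qquad X\in\mathbb{R}^{n\times r}.$$ For $X\in\mathbb{R}^{n\times r}$, the (unpenalized, i.e. $g\equiv 0$) Bregman iteration map of $f$ for the kernel $h_G$ with step size $\lambda>0$, $$T_\lambda(X)=\operatorname*{argmin}_{U\in\mathbb{R}^{n\times r}}\Big\{f(X)+\langle\nabla f(X),U-X\rangle+\frac1\lambda D_{h_G}(U,X)\Big\},$$ is given by $$T_\lambda(X)=V\big[\alpha\,\mathrm{Tr}(Z)\,I_r+\beta Z+\sigma I_r\big]^{-1},$$ where $V\in\mathbb{R}^{n\times r}$ and $Z\in\mathbb{R}^{r\times r}$ are computed as follows: - set $V=\nabla h_G(X)-\lambda\nabla f(X)$; - diagonalize $V^TV=P^TDP$ with $P\in\mathcal{O}_r$ and $D=\mathrm{diag}(\eta_1^2,\dots,\eta_r^2)$; - let $\mu=(\mu_1,\dots,\mu_r)$ be the unique solution of the convex minimization problem $$\min_{x\in\mathbb{R}^r}\ \phi(x):=\frac{\alpha}{4}\|x\|^4+\frac{\beta}{4}\sum_{i=1}^r x_i^4+\frac{\sigma}{2}\|x\|^2-\sum_{i=1}^r\eta_i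 x_i;$$ - set $Z=P^T\mathrm{diag}(\mu_1^2,\dots,\mu_r^2)P$.
   Context: $\|\cdot\|$ is the Frobenius norm on matrices (Euclidean norm on $\mathbb{R}^r$), $\langle X,Y\rangle=\mathrm{Tr}(X^TY)$, and gradients are taken with respect to this inner product. $I_r$ is the $r\times r$ identity matrix and $\mathcal{O}_r$ is the group of $r\times r$ orthogonal matrices. The Bregman distance of a differentiable strictly convex $h$ is $D_h(X,Y)=h(X)-h(Y)-\langle\nabla h(Y),X-Y\rangle$. $F$ is $\mu_F$-strongly convex and $L_F$-smooth, with constants $0\le\mu_F\le L_F$, means that for all $X,Y\in\mathbb{R}^{n\times n}$, $\langle\nabla F(X)-\nabla F(Y),X-Y\rangle\ge\mu_F\|X-Y\|^2$ and $\|\nabla F(X)-\nabla F(Y)\|\le L_F\|X-Y\|$. *)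

(* Defs.v *)
From HB Require Import structures.
From mathcomp Require Import all_boot all_order all_algebra.
From mathcomp Require Import all_classical all_reals all_analysis.
Set Implicit Arguments.
Unset Strict Implicit.
Unset Printing Implicit Defensive.
Import Order.TTheory GRing.Theory Num.Theory.
Import numFieldNormedType.Exports.
Local Open Scope classical_set_scope.
Local Open Scope ring_scope.

(* The library's norm `|X| on matrices is the max norm. It induces the same   *)
(* topology, hence the same differentials, as the Frobenius norm below, which *)
(* is the one used in all quantitative statements.                            *)
Definition frob_inner (R : realType) (m n : nat) (X Y : 'M[R]_(m, n)) : R :=
  \tr (X^T *m Y).

Definition frob_norm (R : realType) (m n : nat) (X : 'M[R]_(m, n)) : R :=
  Num.sqrt (frob_inner X X).

(* By gradientP this is the Riesz representer of 'd f X for frob_inner; 'd f X *)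
(* is only the actual differential where f is differentiable.                 *)
Definition gradient (R : realType) (m n : nat) (f : 'M[R]_(m, n) -> R)
    (X : 'M[R]_(m, n)) : 'M[R]_(m, n) :=
  \matrix_(i < m, j < n) ('d f X : 'M[R]_(m, n) -> R) (delta_mx i j).

Lemma gradientP (R : realType) (m n : nat) (f : 'M[R]_(m, n) -> R)
    (X H : 'M[R]_(m, n)) :
  ('d f X : 'M[R]_(m, n) -> R) H = frob_inner (gradient f X) H.
Proof.
rewrite {1}(matrix_sum_delta H) linear_sum /frob_inner /mxtrace.
under eq_bigr do rewrite linear_sum.
rewrite exchange_big /=; apply: eq_bigr => j _.
rewrite mxE; apply: eq_bigr => i _.
by rewrite linearZ !mxE /= mulrC.
Qed.

(* Continuity of the second differential is required in each direction H,     *)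
(* which is continuity for the operator norm since the space is               *)
(* finite-dimensional.                                                        *)
Definition twice_continuously_differentiable (R : realType) (m n : nat)
    (F : 'M[R]_(m, n) -> R) : Prop :=
  [/\ forall X, differentiable F X,
      forall X, differentiable (gradient F) X &
      forall H, continuous (fun X : 'M[R]_(m, n) =>
        ('d (gradient F) X : 'M[R]_(m, n) -> 'M[R]_(m, n)) H)].

Definition strongly_convex (R : realType) (m n : nat) (mu : R)
    (F : 'M[R]_(m, n) -> R) : Prop :=
  forall X Y, mu * frob_norm (X - Y) ^+ 2 <=
    frob_inner (gradient F X - gradient F Y) (X - Y).

Definition smooth (R : realType) (m n : nat) (L : R)
    (F : 'M[R]_(m, n) -> R) : Prop :=
  forall X Y,
    frob_norm (gradient F X - gradient F Y) <= L * frob_norm (X - Y).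

Definition bregman (R : realType) (m n : nat) (h : 'M[R]_(m, n) -> R)
    (X Y : 'M[R]_(m, n)) : R :=
  h X - h Y - frob_inner (gradient h Y) (X - Y).

Definition argmin (R : realType) (T : Type) (q : T -> R) : set T :=
  [set x | forall y, q x <= q y].

(* The set of all minimizers: existence and uniqueness are not built in.      *)
Definition bregman_step (R : realType) (m n : nat)
    (f h : 'M[R]_(m, n) -> R) (lambda : R) (X : 'M[R]_(m, n)) :
    set 'M[R]_(m, n) :=
  argmin (fun U => f X + frob_inner (gradient f X) (U - X)
                   + lambda^-1 * bregman h U X).

Definition gram_kernel (R : realType) (n r : nat) (alpha beta sigma : R)
    (X : 'M[R]_(n, r)) : R :=
  alpha / 4 * frob_norm X ^+ 4 + beta / 4 * frob_norm (X^T *m X) ^+ 2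
  + sigma / 2 * frob_norm X ^+ 2.

Definition factored (R : realType) (n r : nat) (F : 'M[R]_n -> R)
    (X : 'M[R]_(n, r)) : R :=
  F (X *m X^T).

Definition orthogonal_mx (R : realType) (r : nat) (P : 'M[R]_r) : Prop :=
  P^T *m P = 1%:M.

Definition diag_sqr (R : realType) (r : nat) (x : 'rV[R]_r) : 'M[R]_r :=
  diag_mx (\row_(i < r) x 0 i ^+ 2).

(* eta is a vector of (square roots of) eigenvalues of A; its entries are not *)
(* required to be nonnegative or sorted.                                      *)
Definition diagonalizes (R : realType) (r : nat) (A P : 'M[R]_r)
    (eta : 'rV[R]_r) : Prop :=
  orthogonal_mx P /\ A = P^T *m diag_sqr eta *m P.

Definition spectral_objective (R : realType) (r : nat)
    (alpha beta sigma : R) (eta x : 'rV[R]_r) : R :=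
  alpha / 4 * frob_norm x ^+ 4 + beta / 4 * \sum_(i < r) x 0 i ^+ 4
  + sigma / 2 * frob_norm x ^+ 2 - \sum_(i < r) eta 0 i * x 0 i.

(* Main.v *)
Require Import Defs.
From HB Require Import structures.
From mathcomp Require Import all_boot all_order all_algebra.
From mathcomp Require Import all_classical all_reals all_analysis.
From mathcomp Require Import ring lra.
Import Order.TTheory GRing.Theory Num.Theory.
Import numFieldNormedType.Exports.
Local Open Scope classical_set_scope.
Local Open Scope ring_scope.

(** The gradients at [X] enter the Bregman step only through
[V = gradient h X - lambda *: gradient f X]: collecting the linear terms, its
minimizers are those of [h U - <V, U>] ([bregman_step_argmin]).  The proposition is thus a statement
about [h = gram_kernel alpha beta sigma] and one fixed matrix [V].

Write [G Z = (alpha * \tr Z)%:M + beta *: Z + sigma%:M].  Expanding [h] exactly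
around [W] ([gram_kernelD]) exhibits [W *m G (W^T *m W)] as its gradient, with a
remainder that is at least [sigma / 2] times the squared length of the increment.
Hence a solution of the stationarity equation [W *m G (W^T *m W) = V] is the one
and only minimizer of [h U - <V, U>] ([stationary_argmin]).  Conversely, a
minimizer along a line is stationary in the direction of that line
([stationary_of_line_min]).

The spectral objective is the same function, with [V] replaced by [diag_mx eta],
restricted to diagonal matrices ([spectral_objectiveE]).  It is therefore convex;
being continuous and coercive it has a minimizer [mu]; and since the stationarity
equation of a diagonal matrix is diagonal, [mu] satisfies
[diag_mx mu *m G (diag_sqr mu) = diag_mx eta] in the space of all matrices.

Conjugating by [P] turns this into [Q *m M = diag_mx eta *m P] for
[Q = diag_mx mu *m P], [Z = Q^T *m Q] and [M = G Z].  Taking Gram matrices,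
[M^T *m Z *m M = V^T *m V], so [W = V *m invmx M] has [W^T *m W = Z].  Then
[W *m G (W^T *m W) = W *m M = V], and [W] is the minimizer.

The existence of [P] and [eta] is the spectral theorem for real symmetric
matrices, proved by minimizing the quadratic form over the unit sphere and
deflating with a Householder reflection. *)

Set Implicit Arguments.
Unset Strict Implicit.

(** * The Frobenius inner product *)

Section FrobeniusInnerProduct.
Variable R : realType.
Implicit Types m n p : nat.

Lemma frob_innerE m n (A B : 'M[R]_(m, n)) :
  frob_inner A B = \sum_i \sum_j A i j * B i j.
Proof.
rewrite /frob_inner /mxtrace exchange_big /=; apply: eq_bigr => j _.
by rewrite mxE; apply: eq_bigr => i _; rewrite mxE.
Qed.

Lemma frob_innerC m n (A B : 'M[R]_(m, n)) : frob_inner A B = frob_inner B A.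
Proof. by rewrite /frob_inner -mxtrace_tr trmx_mul trmxK. Qed.

Lemma frob_innerDr m n (A B C : 'M[R]_(m, n)) :
  frob_inner A (B + C) = frob_inner A B + frob_inner A C.
Proof. by rewrite /frob_inner mulmxDr mxtraceD. Qed.

Lemma frob_innerZr m n a (A B : 'M[R]_(m, n)) :
  frob_inner A (a *: B) = a * frob_inner A B.
Proof. by rewrite /frob_inner -scalemxAr mxtraceZ. Qed.

Lemma frob_innerNr m n (A B : 'M[R]_(m, n)) :
  frob_inner A (- B) = - frob_inner A B.
Proof. by rewrite -scaleN1r frob_innerZr mulN1r. Qed.

Lemma frob_innerDl m n (A B C : 'M[R]_(m, n)) :
  frob_inner (A + B) C = frob_inner A C + frob_inner B C.
Proof. by rewrite frob_innerC frob_innerDr !(frob_innerC C). Qed.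

Lemma frob_innerZl m n a (A B : 'M[R]_(m, n)) :
  frob_inner (a *: A) B = a * frob_inner A B.
Proof. by rewrite frob_innerC frob_innerZr frob_innerC. Qed.

Lemma frob_innerNl m n (A B : 'M[R]_(m, n)) :
  frob_inner (- A) B = - frob_inner A B.
Proof. by rewrite frob_innerC frob_innerNr frob_innerC. Qed.

Lemma frob_inner0l m n (A : 'M[R]_(m, n)) : frob_inner 0 A = 0.
Proof. by rewrite -(scale0r A) frob_innerZl mul0r. Qed.

Lemma frob_inner_tr m n (A B : 'M[R]_(m, n)) :
  frob_inner A^T B^T = frob_inner A B.
Proof. by rewrite /frob_inner mxtrace_mulC -mxtrace_tr trmx_mul !trmxK. Qed.

Lemma frob_inner_mull m n p (A : 'M[R]_(m, n)) (B : 'M[R]_(n, p))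
    (C : 'M[R]_(m, p)) :
  frob_inner (A *m B) C = frob_inner B (A^T *m C).
Proof. by rewrite /frob_inner trmx_mul -mulmxA. Qed.

Lemma frob_inner_mulr m n p (A : 'M[R]_(m, n)) (B : 'M[R]_(n, p))
    (C : 'M[R]_(m, p)) :
  frob_inner (A *m B) C = frob_inner A (C *m B^T).
Proof. by rewrite /frob_inner trmx_mul -mulmxA mxtrace_mulC mulmxA. Qed.

Lemma frob_inner_ge0 m n (A : 'M[R]_(m, n)) : 0 <= frob_inner A A.
Proof.
by rewrite frob_innerE; do 2!apply: sumr_ge0 => ? _; rewrite -expr2 sqr_ge0.
Qed.

Lemma le_frob_inner_sqr m n (A : 'M[R]_(m, n)) i j :
  A i j ^+ 2 <= frob_inner A A.
Proof.
rewrite frob_innerE (bigD1 i) //= (bigD1 j) //= -expr2 -addrA lerDl addr_ge0 //.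
  by apply: sumr_ge0 => k _; rewrite -expr2 sqr_ge0.
by do 2!apply: sumr_ge0 => ? _; rewrite -expr2 sqr_ge0.
Qed.

Lemma frob_inner_eq0 m n (A : 'M[R]_(m, n)) : frob_inner A A = 0 -> A = 0.
Proof.
move=> A0; apply/matrixP => i j; rewrite mxE; apply/eqP.
by rewrite -sqrf_eq0 eq_le sqr_ge0 andbT -A0 le_frob_inner_sqr.
Qed.

Lemma frob_norm_sqr m n (A : 'M[R]_(m, n)) : frob_norm A ^+ 2 = frob_inner A A.
Proof. by rewrite sqr_sqrtr ?frob_inner_ge0. Qed.

Lemma frob_norm_pow4 m n (A : 'M[R]_(m, n)) :
  frob_norm A ^+ 4 = frob_inner A A ^+ 2.
Proof. by rewrite -frob_norm_sqr -exprM. Qed.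

Lemma frob_inner_continuous (T : topologicalType) m n (f g : T -> 'M[R]_(m, n)) :
  (forall i j, continuous (fun x => f x i j : R)) ->
  (forall i j, continuous (fun x => g x i j : R)) ->
  continuous (fun x => frob_inner (f x) (g x) : R).
Proof.
move=> fc gc.
have -> : (fun x => frob_inner (f x) (g x))
    = (fun x => \sum_i \sum_j f x i j * g x i j).
  by apply/funext => x; rewrite frob_innerE.
move=> x; apply: cvg_big => [|i _]; first exact: add_continuous.
apply: cvg_big => [|j _]; first exact: add_continuous.
by apply: cvgM; [exact: fc|exact: gc].
Qed.

End FrobeniusInnerProduct.

(** * Existence of minimizers and a first-order condition *)

Section Minimization.
Variable R : realType.

(** A Euclidean bound encloses [A] in a box, compact as a product of segments. *)
Lemma bounded_attains_min n (A : set 'rV[R]_n) (f : 'rV[R]_n -> R) (B : R) :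
  A !=set0 -> closed A -> (forall x, A x -> frob_inner x x <= B) ->
  continuous f ->
  exists2 x, A x & forall y, A y -> f x <= f y.
Proof.
move=> A0 Acl AB fc.
have box_compact : compact [set x : 'rV[R]_n |
    forall i, `[- (B + 1), B + 1]%classic (x ord0 i)].
  by apply: (@rV_compact _ _ (fun=> _)) => _; exact: segment_compact.
have Acompact : compact A.
  apply: subclosed_compact Acl box_compact _ => x Ax i /=.
  have xB := le_trans (le_frob_inner_sqr x ord0 i) (AB _ Ax).
  by rewrite in_itv /=; apply/andP; split; nra.
have [x /set_mem Ax xmin] := EVT_min_rV A0 Acompact (continuous_subspaceT fc).
by exists x => // y Ay; exact/xmin/mem_set.
Qed.

(** First-order condition for polynomials.  This replaces differentiation: along a
line, the functions minimized below are quartic polynomials in the parameter. *)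
Lemma quartic_ge0_linear_coef_eq0 (a b c d : R) :
  (forall t, 0 <= a * t + b * t ^+ 2 + c * t ^+ 3 + d * t ^+ 4) -> a = 0.
Proof.
move=> q_ge0; apply/eqP; rewrite -normr_eq0 eq_le normr_ge0 andbT leNgt.
apply/negP => a_gt0; pose K := `|b| + `|c| + `|d|.
have K_ge0 : 0 <= K by rewrite !addr_ge0.
(* A step [- Num.sg a * s] with [s <= 1] gives [`|a| * s <= K * s ^+ 2], which
   fails as soon as [K * s < `|a|]. *)
pose s := `|a| / (`|a| + K + 1).
have s_gt0 : 0 < s by apply: divr_gt0; lra.
have sE : s * (`|a| + K + 1) = `|a| by rewrite /s mulfVK // gt_eqF //; lra.
have s_le1 : s <= 1 by nra.
have := q_ge0 (- Num.sg a * s).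
have -> : a * (- Num.sg a * s) = - (`|a| * s).
  by rewrite normrEsg; ring.
have sgs : (- Num.sg a * s) ^+ 2 = s ^+ 2.
  rewrite exprMn sqrrN sqr_sg; case: eqP => [a0|]; rewrite ?mul1r //.
  by rewrite a0 normr0 ltxx in a_gt0.
have -> : (- Num.sg a * s) ^+ 4 = s ^+ 4.
  by rewrite -[4%N]/(2 * 2)%N !exprM sgs.
rewrite [_ ^+ 3]exprS sgs.
have h2 : b * s ^+ 2 <= `|b| * s ^+ 2 by rewrite ler_wpM2r ?sqr_ge0 ?ler_norm.
have h4 : d * s ^+ 4 <= `|d| * s ^+ 2.
  apply: le_trans (_ : `|d| * s ^+ 4 <= _).
    by rewrite ler_wpM2r ?exprn_ge0 ?ler_norm // ltW.
  by rewrite ler_wpM2l // ler_wiXn2l // ltW.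
have h3 : c * (- Num.sg a * s * s ^+ 2) <= `|c| * s ^+ 2.
  apply: le_trans (ler_norm _) _; rewrite normrM ler_wpM2l //.
  rewrite normrM (ger0_norm (sqr_ge0 s)) ler_piMl ?sqr_ge0 // normrM normrN.
  by rewrite (gtr0_norm s_gt0) mulr_ile1 ?(ltW s_gt0) // normr_sg lern1 leq_b1.
suff : K * s ^+ 2 < `|a| * s by rewrite /K; lra.
by rewrite expr2 mulrA ltr_pM2r //; nra.
Qed.

End Minimization.

(** * The spectral theorem for real symmetric matrices *)

Section SpectralTheorem.
Variable R : realType.

(** A minimizer [v] of the quadratic form [q] of [A] on the unit sphere has, by
homogeneity, [q v * <x, x> <= q x] for every [x], with equality at [v]; the linear
term of this inequality along a line through [v] says that [v] is an
eigenvector. *)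
Lemma symmetric_eigenvector n (A : 'M[R]_n.+1) : A^T = A ->
  exists2 v : 'rV[R]_n.+1, frob_inner v v = 1 & exists a, v *m A = a *: v.
Proof.
move=> A_sym; pose q (x : 'rV[R]_n.+1) : R := frob_inner (x *m A) x.
have coordc i j : continuous (fun x : 'rV[R]_n.+1 => x i j : R).
  exact: coord_continuous.
have qc : continuous q.
  apply: frob_inner_continuous => // i j.
  have -> : (fun x : 'rV[R]_n.+1 => (x *m A) i j)
      = (fun x : 'rV[R]_n.+1 => \sum_k x i k * A k j).
    by apply/funext => x; rewrite mxE.
  apply: continuous_big => [|k _ x]; first exact: add_continuous.
  by apply: continuousM; [exact: coordc|exact: cst_continuous].
pose sphere := [set x : 'rV[R]_n.+1 | frob_inner x x = 1].
have sphere0 : sphere !=set0.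
  exists (delta_mx ord0 ord0); rewrite /sphere /= frob_innerE big_ord1.
  rewrite (bigD1 ord0) //= !mxE !eqxx mulr1 big1 ?addr0 //.
  by move=> j /negPf j0; rewrite !mxE j0 mul0r.
have sphere_closed : closed sphere.
  apply: (@preimage_closed _ _ (fun x : 'rV[R]_n.+1 => frob_inner x x : R)
    [set y | y = 1]) => [x _|]; last exact: closed_eq.
  exact: frob_inner_continuous.
have sphere_bounded x : sphere x -> frob_inner x x <= 1 by move=> ->.
have [v v1 vmin] :=
  bounded_attains_min sphere0 sphere_closed sphere_bounded qc.
exists v => //; exists (q v).
have q_ge x : q v * frob_inner x x <= q x.
  have [->|x0] := eqVneq x 0.
    by rewrite /q mul0mx !frob_inner0l mulr0.
  have xx : 0 < frob_inner x x.
    rewrite lt_neqAle frob_inner_ge0 andbT eq_sym.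
    by apply: contra_neq x0; exact: frob_inner_eq0.
  pose s := (Num.sqrt (frob_inner x x))^-1.
  have s2 : s ^+ 2 = (frob_inner x x)^-1.
    by rewrite exprVn sqr_sqrtr // ltW.
  have /vmin : sphere (s *: x).
    by rewrite /sphere /= frob_innerZl frob_innerZr mulrA -expr2 s2 mulVf ?gt_eqF.
  rewrite {2}/q -scalemxAl frob_innerZl frob_innerZr mulrA -expr2 s2.
  by rewrite mulrC ler_pdivlMr.
(* Abstracting [w] keeps bilinearity from expanding it as a difference. *)
have [w wE] : exists w, w = v *m A - q v *: v by exists (v *m A - q v *: v).
suff /frob_inner_eq0 : frob_inner w w = 0.
  by rewrite wE => /eqP; rewrite subr_eq0 => /eqP.
(* The inequality along [v + t *: w] has linear coefficient [2 * <w, w>]. *)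
apply: (mulfI (x := 2)) => //; rewrite mulr0.
apply: (@quartic_ge0_linear_coef_eq0 _ _
  (q w - q v * frob_inner w w) 0 0) => t.
have := q_ge (v + t *: w).
have wAv : frob_inner (w *m A) v = frob_inner (v *m A) w.
  by rewrite frob_inner_mulr A_sym frob_innerC.
have ww : frob_inner w w = frob_inner (v *m A) w - q v * frob_inner v w.
  by rewrite {1}wE frob_innerDl frob_innerNl frob_innerZl.
rewrite {2}/q mulmxDl -scalemxAl.
rewrite !(frob_innerDl, frob_innerDr, frob_innerZl, frob_innerZr) wAv.
rewrite -/(q v) -/(q w) (frob_innerC w v) v1 -subr_ge0 => h.
by rewrite {1}ww; lra.
Qed.

(** The Householder reflection [1 - 2 w^T w / <w, w>] with [w = v - e] exchanges the
first basis vector [e] and [v]. *)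
Lemma exists_orthogonal_with_row0 n (v : 'rV[R]_n.+1) : frob_inner v v = 1 ->
  exists2 H : 'M[R]_n.+1, H *m H^T = 1%:M & row ord0 H = v.
Proof.
move=> v1; pose e : 'rV[R]_n.+1 := delta_mx ord0 ord0.
have [w wE] : exists w, w = v - e by exists (v - e).
have [w0|w0] := eqVneq w 0.
  exists 1%:M; first by rewrite trmx1 mulmx1.
  by rewrite rowE mulmx1; apply/esym/eqP; rewrite -subr_eq0 -wE w0.
have dotE (x y : 'rV[R]_n.+1) : x *m y^T = (frob_inner x y)%:M.
  rewrite [LHS]mx11_scalar frob_innerE big_ord1 mxE; congr _%:M.
  by apply: eq_bigr => j _; rewrite mxE.
have ee : frob_inner e e = 1.
  rewrite frob_innerE big_ord1 (bigD1 ord0) //= !mxE !eqxx mulr1 big1 ?addr0 //.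
  by move=> j /negPf j0; rewrite !mxE j0 mul0r.
have ww : frob_inner w w = - 2 * frob_inner e w.
  rewrite wE !(frob_innerDl, frob_innerDr, frob_innerNl, frob_innerNr).
  by rewrite v1 ee (frob_innerC v e); ring.
have ww0 : frob_inner w w != 0 by apply: contra_neq w0; exact: frob_inner_eq0.
pose c := 2 / frob_inner w w; have cww : c * frob_inner w w = 2 by rewrite mulfVK.
have [K KE] : exists K, K = w^T *m w by exists (w^T *m w).
have K_sym : K^T = K by rewrite KE trmx_mul trmxK.
have KK : K *m K = frob_inner w w *: K.
  by rewrite KE -mulmxA (mulmxA w) dotE mul_scalar_mx scalemxAr.
have H_sym : (1%:M - c *: K)^T = 1%:M - c *: K.
  by rewrite linearB linearZ /= trmx1 K_sym.
have cKK : (c *: K) *m (c *: K) = c *: K + c *: K.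
  rewrite -scalemxAl -scalemxAr KK !scalerA -mulrA cww mulrC -scalerA.
  by rewrite scaler_nat mulr2n.
exists (1%:M - c *: K).
  rewrite H_sym mulmxBl mul1mx mulmxBr mulmx1 cKK.
  by rewrite opprB addrK subrK.
rewrite rowE -/e mulmxBr mulmx1 -scalemxAr KE mulmxA dotE mul_scalar_mx scalerA.
have -> : c * frob_inner e w = -1 by rewrite ww in cww; lra.
by rewrite scaleN1r opprK wE addrC subrK.
Qed.

(** With an eigenvector as first row of an orthogonal [H], symmetry makes
[H *m A *m H^T] block diagonal, and the induction applies to the second block. *)
Theorem symmetric_diagonalizable r (A : 'M[R]_r) : A^T = A ->
  exists (P : 'M[R]_r) (d : 'rV[R]_r),
    P *m P^T = 1%:M /\ A = P^T *m diag_mx d *m P.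
Proof.
elim: r A => [|r IHr] A A_sym.
  by exists 1%:M, 0; split; apply/matrixP; case.
have [v v1 [a vA]] := symmetric_eigenvector A_sym.
have [H HHt H0] := exists_orthogonal_with_row0 v1.
have HtH : H^T *m H = 1%:M by exact: mulmx1C.
pose B : 'M[R]_(1 + r) := H *m A *m H^T.
have B_sym : B^T = B by rewrite /B !trmx_mul trmxK A_sym mulmxA.
have B0 : row ord0 B = a *: delta_mx ord0 ord0.
  by rewrite /B !row_mul H0 vA -scalemxAl -H0 -row_mul HHt rowE mulmx1.
have A_B : A = H^T *m B *m H.
  by rewrite /B !mulmxA HtH mul1mx -mulmxA HtH mulmx1.
move: B B_sym B0 A_B => B B_sym B0 ->.
have B0k k : B ord0 k = a *+ (k == ord0).
  by move/rowP/(_ k): B0; rewrite !mxE => ->; rewrite eqxx mulr_natr.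
have lshift0 (i : 'I_1) : lshift r i = ord0 by rewrite ord1; exact: val_inj.
have B_block : B = block_mx a%:M 0 0 (drsubmx B).
  have Bur : ursubmx B = 0.
    by apply/matrixP => i j; rewrite !mxE lshift0 B0k.
  rewrite -[LHS]submxK; congr block_mx => //; last first.
    by rewrite -B_sym -trmx_ursub Bur trmx0.
  by apply/matrixP => i j; rewrite !mxE !lshift0 B0k eqxx !ord1.
have [|P' [d [PPt BP]]] := IHr (drsubmx B).
  by rewrite trmx_drsub B_sym.
pose Q : 'M[R]_(1 + r) := block_mx 1%:M 0 0 P'.
have Qt : Q^T = block_mx 1%:M 0 0 P'^T by rewrite tr_block_mx trmx1 !trmx0.
have QQt : Q *m Q^T = 1%:M.
  rewrite Qt mulmx_block !(mulmx0, mul0mx, mulmx1, addr0, add0r) PPt.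
  by rewrite -scalar_mx_block.
have BQ : B = Q^T *m diag_mx (row_mx a%:M d) *m Q.
  rewrite Qt diag_mx_row !mulmx_block.
  rewrite !(mulmx0, mul0mx, mulmx1, mul1mx, addr0, add0r) -BP {1}B_block.
  by congr block_mx; apply/matrixP => i j; rewrite !mxE !ord1 !eqxx.
exists (Q *m H), (row_mx a%:M d); split.
  by rewrite trmx_mul mulmxA -(mulmxA Q) HHt mulmx1.
by rewrite {1}BQ trmx_mul !mulmxA.
Qed.

(** The eigenvalues of a Gram matrix are squared lengths of columns of [V *m P^T],
so they have square roots. *)
Corollary gram_diagonalizable n r (V : 'M[R]_(n, r)) :
  exists (P : 'M[R]_r) (eta : 'rV[R]_r), diagonalizes (V^T *m V) P eta.
Proof.
have [|P [d [PPt VE]]] := @symmetric_diagonalizable _ (V^T *m V).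
  by rewrite trmx_mul trmxK.
exists P, (\row_i Num.sqrt (d 0 i)); split; first exact: mulmx1C.
rewrite VE; congr (_ *m _ *m _); rewrite /diag_sqr; congr diag_mx.
apply/rowP => i; rewrite !mxE sqr_sqrtr //.
have -> : d 0 i = frob_inner (col i (V *m P^T)) (col i (V *m P^T)).
  have -> : d 0 i = (diag_mx d) i i by rewrite mxE eqxx.
  have -> : diag_mx d = (V *m P^T)^T *m (V *m P^T).
    rewrite trmx_mul trmxK mulmxA -(mulmxA P) VE !mulmxA PPt mul1mx.
    by rewrite -mulmxA PPt mulmx1.
  rewrite mxE /frob_inner /mxtrace big_ord1 mxE.
  by apply: eq_bigr => k _; rewrite !mxE.
exact: frob_inner_ge0.
Qed.

End SpectralTheorem.

(** * The kernel: exact expansion and stationary points *)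

Section GramKernel.
Variables (R : realType) (alpha beta sigma : R).

(** The gradient of the kernel at [W] is [W *m gram_multiplier (W^T *m W)], by
[gram_kernelD]. *)
Definition gram_multiplier r (Z : 'M[R]_r) : 'M[R]_r :=
  (alpha * \tr Z)%:M + beta *: Z + sigma%:M.

(** Everything of order at least two in [E], arranged so that each summand is visibly
nonnegative. *)
Definition gram_remainder m n (W E : 'M[R]_(m, n)) : R :=
  alpha / 4 * ((2 * frob_inner W E + frob_inner E E) ^+ 2
               + 2 * frob_inner W W * frob_inner E E)
  + beta / 4 * (frob_inner (W^T *m E + E^T *m W + E^T *m E)
                           (W^T *m E + E^T *m W + E^T *m E)
                + 2 * frob_inner (W *m E^T) (W *m E^T))
  + sigma / 2 * frob_inner E E.

(** With [a], [b], [c] the inner products of [W] and [E], the scalar quartic term is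
[(a + 2 b + c)^2 = a^2 + 4 a b + ((2 b + c)^2 + 2 a c)].  The Gram term follows the
same pattern, with [<W^T W, E^T W> = <W^T W, W^T E>] by symmetry, and
[<W^T W, E^T E> = <W E^T, W E^T>], a square. *)
Lemma gram_kernelD m n (W E : 'M[R]_(m, n)) :
  gram_kernel alpha beta sigma (W + E) =
  gram_kernel alpha beta sigma W
  + frob_inner (W *m gram_multiplier (W^T *m W)) E + gram_remainder W E.
Proof.
have gramD : (W + E)^T *m (W + E)
    = W^T *m W + (W^T *m E + E^T *m W + E^T *m E).
  by rewrite [(W + E)^T]linearD /= mulmxDl !mulmxDr !addrA.
have WWE : frob_inner (W *m (W^T *m W)) E = frob_inner (W^T *m W) (W^T *m E).
  exact: frob_inner_mull.
have WWEt : frob_inner (W^T *m W) (E^T *m W) = frob_inner (W^T *m W) (W^T *m E).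
  by rewrite -frob_inner_tr !trmx_mul !trmxK.
have WWEE : frob_inner (W^T *m W) (E^T *m E) = frob_inner (W *m E^T) (W *m E^T).
  by rewrite [RHS]frob_inner_mull frob_innerC frob_inner_mulr mulmxA.
have WGE : frob_inner (W *m gram_multiplier (W^T *m W)) E
    = alpha * frob_inner W W * frob_inner W E
      + beta * frob_inner (W^T *m W) (W^T *m E) + sigma * frob_inner W E.
  rewrite /gram_multiplier !mulmxDr !mul_mx_scalar -scalemxAr.
  by rewrite !frob_innerDl !frob_innerZl WWE.
rewrite /gram_kernel /gram_remainder !frob_norm_pow4 !frob_norm_sqr gramD WGE.
move: WWEt WWEE.
move: (W^T *m W) (W^T *m E) (E^T *m W) (E^T *m E) (W *m E^T) => B S1 S2 Q T BS BQ.
rewrite !(frob_innerDl, frob_innerDr) BS -BQ (frob_innerC E W).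
rewrite (frob_innerC S1 B) (frob_innerC S2 B) (frob_innerC Q B) BS.
by field.
Qed.

Hypotheses (alpha_ge0 : 0 <= alpha) (beta_ge0 : 0 <= beta).

Lemma gram_remainder_ge m n (W E : 'M[R]_(m, n)) :
  sigma / 2 * frob_inner E E <= gram_remainder W E.
Proof.
rewrite /gram_remainder lerDr; apply: addr_ge0; apply: mulr_ge0.
- by rewrite divr_ge0.
- by rewrite addr_ge0 ?sqr_ge0 // !mulr_ge0 ?frob_inner_ge0.
- by rewrite divr_ge0.
- by rewrite addr_ge0 ?mulr_ge0 ?frob_inner_ge0.
Qed.

Definition tilted m n (V U : 'M[R]_(m, n)) : R :=
  gram_kernel alpha beta sigma U - frob_inner V U.

(** Strong convexity, in the form used for both uniqueness and convexity. *)
Lemma tilted_linear_lower_bound m n (V W U : 'M[R]_(m, n)) :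
  tilted V W + frob_inner (W *m gram_multiplier (W^T *m W) - V) (U - W)
    + sigma / 2 * frob_inner (U - W) (U - W) <= tilted V U.
Proof.
have -> : tilted V U = tilted V (W + (U - W)) by rewrite addrC subrK.
move: (U - W) => E.
rewrite /tilted gram_kernelD frob_innerDl frob_innerDr frob_innerNl.
have := gram_remainder_ge W E; lra.
Qed.

(** The converse of stationarity implying minimality, one direction at a time: this
is what lets a minimizer among diagonal matrices be tested only against diagonal
directions. *)
Lemma stationary_of_line_min m n (V W E : 'M[R]_(m, n)) :
  (forall t, tilted V W <= tilted V (W + t *: E)) ->
  frob_inner (W *m gram_multiplier (W^T *m W) - V) E = 0.
Proof.
move=> W_min; pose S := W^T *m E + E^T *m W; pose Q := E^T *m E.
pose b := frob_inner W E; pose c := frob_inner E E.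
apply: (@quartic_ge0_linear_coef_eq0 _ _
  (alpha / 4 * (4 * b ^+ 2 + 2 * frob_inner W W * c)
   + beta / 4 * (frob_inner S S + 2 * frob_inner (W *m E^T) (W *m E^T))
   + sigma / 2 * c)
  (alpha * b * c + beta / 2 * frob_inner S Q)
  (alpha / 4 * c ^+ 2 + beta / 4 * frob_inner Q Q)) => t.
have := W_min t; rewrite /tilted gram_kernelD -subr_ge0 => h.
apply: le_trans h _; rewrite le_eqVlt; apply/orP; left; apply/eqP.
rewrite /gram_remainder.
have -> : W^T *m (t *: E) + (t *: E)^T *m W + (t *: E)^T *m (t *: E)
    = t *: S + t ^+ 2 *: Q.
  rewrite [(t *: E)^T]linearZ /= -!scalemxAr -!scalemxAl scalerA -expr2.
  by rewrite /S scalerDr.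
rewrite [(t *: E)^T]linearZ /= -scalemxAr.
clearbody S Q.
rewrite !(frob_innerDl, frob_innerDr, frob_innerNl, frob_innerZl, frob_innerZr).
rewrite -/b -/c (frob_innerC Q S).
by field.
Qed.

Lemma stationary_argmin m n (V W : 'M[R]_(m, n)) : 0 < sigma ->
  W *m gram_multiplier (W^T *m W) = V -> argmin (tilted V) = [set W].
Proof.
move=> sigma_gt0 WV.
have lb U : tilted V W + sigma / 2 * frob_inner (U - W) (U - W) <= tilted V U.
  have := tilted_linear_lower_bound V W U.
  by rewrite WV subrr frob_inner0l addr0.
apply/seteqP; split => [U /= U_min | _ -> U] /=; last first.
  apply: le_trans (lb U); rewrite lerDl mulr_ge0 ?frob_inner_ge0 //.
  by rewrite divr_ge0 // ltW.
apply/eqP; rewrite -subr_eq0; apply/eqP/frob_inner_eq0/eqP.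
rewrite eq_le frob_inner_ge0 andbT; have := lb U; have := U_min W.
have := frob_inner_ge0 (U - W); nra.
Qed.

End GramKernel.

(** * The Bregman step as a tilted minimization *)

(** For an arbitrary kernel, the objective of the step differs from
[lambda^-1 * (h U - <V, U>)] by a constant in [U]. *)
Lemma bregman_step_argmin (R : realType) m n (f h : 'M[R]_(m, n) -> R)
    (lambda : R) (X : 'M[R]_(m, n)) : 0 < lambda ->
  bregman_step f h lambda X =
  argmin (fun U => h U
    - frob_inner (gradient h X - lambda *: gradient f X) U).
Proof.
move=> lambda_gt0; have lambda0 : lambda != 0 by rewrite gt_eqF.
have stepE U W :
    (f X + frob_inner (gradient f X) (W - X) + lambda^-1 * bregman h W X)
    - (f X + frob_inner (gradient f X) (U - X) + lambda^-1 * bregman h U X)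
    = lambda^-1 *
      ((h W - frob_inner (gradient h X - lambda *: gradient f X) W)
       - (h U - frob_inner (gradient h X - lambda *: gradient f X) U)).
  rewrite /bregman; move: (gradient h X) (gradient f X) => gh gf.
  rewrite !(frob_innerDl, frob_innerDr, frob_innerNl, frob_innerNr, frob_innerZl).
  by field.
apply/seteqP; split => U U_min W.
  have := U_min W; rewrite /= -subr_ge0 stepE pmulr_rge0 ?invr_gt0 //.
  by rewrite subr_ge0.
rewrite /= -subr_ge0 stepE mulr_ge0 ?invr_ge0 ?(ltW lambda_gt0) // subr_ge0.
exact: U_min.
Qed.

(** * The spectral objective as the restriction to diagonal matrices *)

Section SpectralObjective.
Variables (R : realType) (r : nat) (alpha beta sigma : R).
Implicit Types x y eta mu : 'rV[R]_r.

Lemma diag_mx_gram x : (diag_mx x)^T *m diag_mx x = diag_sqr x.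
Proof.
by rewrite tr_diag_mx mulmx_diag; congr diag_mx; apply/rowP => i; rewrite !mxE.
Qed.

Lemma frob_inner_diag x y : frob_inner (diag_mx x) (diag_mx y) = frob_inner x y.
Proof.
rewrite /frob_inner tr_diag_mx mulmx_diag mxtrace_diag.
rewrite -[RHS]/(frob_inner x y) frob_innerE big_ord1.
by apply: eq_bigr => i _; rewrite mxE.
Qed.

Lemma spectral_objectiveE eta x :
  spectral_objective alpha beta sigma eta x =
  tilted alpha beta sigma (diag_mx eta) (diag_mx x).
Proof.
rewrite /spectral_objective /tilted /gram_kernel !frob_norm_pow4 !frob_norm_sqr.
rewrite diag_mx_gram !frob_inner_diag (frob_innerE eta) big_ord1.
congr (_ + _ * _ + _ - _); rewrite frob_innerE big_ord1.
by apply: eq_bigr => i _; rewrite mxE -exprD.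
Qed.

Hypotheses (alpha_ge0 : 0 <= alpha) (beta_ge0 : 0 <= beta).

(** The affine lower bounds of [tilted_linear_lower_bound] at the intermediate point,
weighted by [t] and [1 - t], add up to the convexity inequality. *)
Lemma spectral_objective_convex eta : 0 <= sigma ->
  convex_function [set: 'rV[R]_r] (spectral_objective alpha beta sigma eta).
Proof.
move=> sigma_ge0 t x y _ _.
have t_ge0 : 0 <= t%:num by [].
have t_le1 : t%:num <= 1 by [].
change (spectral_objective alpha beta sigma eta
    (t%:num *: x + (1 - t%:num) *: y)
  <= t%:num * spectral_objective alpha beta sigma eta x
     + (1 - t%:num) * spectral_objective alpha beta sigma eta y).
move: (t%:num) t_ge0 t_le1 => s s_ge0 s_le1.
rewrite !spectral_objectiveE.
have [W WE] : exists W, W = diag_mx (s *: x + (1 - s) *: y) by eexists.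
pose G := W *m gram_multiplier alpha beta sigma (W^T *m W) - diag_mx eta.
have lb U : tilted alpha beta sigma (diag_mx eta) W + frob_inner G (U - W)
    <= tilted alpha beta sigma (diag_mx eta) U.
  apply: le_trans (tilted_linear_lower_bound sigma alpha_ge0 beta_ge0 _ W U).
  by rewrite lerDl mulr_ge0 ?frob_inner_ge0 ?divr_ge0.
have GW : s * frob_inner G (diag_mx x - W)
    + (1 - s) * frob_inner G (diag_mx y - W) = 0.
  rewrite -!frob_innerZr -frob_innerDr.
  have -> : s *: (diag_mx x - W) + (1 - s) *: (diag_mx y - W) = 0.
    rewrite !scalerBr addrACA -opprD -scalerDl (addrC s) subrK scale1r.
    by rewrite WE linearD !linearZ subrr.
  by rewrite -(scale0r 0) frob_innerZr mul0r.
rewrite -WE; have := lb (diag_mx x); have := lb (diag_mx y); nra.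
Qed.

Lemma spectral_objective_continuous eta :
  continuous (spectral_objective alpha beta sigma eta).
Proof.
have coordc (i : 'I_1) (j : 'I_r) : continuous (fun x : 'rV[R]_r => x i j : R).
  exact: coord_continuous.
have sqrc : continuous (fun x : 'rV[R]_r => frob_inner x x : R).
  exact: frob_inner_continuous.
have -> : spectral_objective alpha beta sigma eta =
    fun x => alpha / 4 * (frob_inner x x * frob_inner x x)
      + beta / 4 * (\sum_(i < r) (x 0 i * x 0 i) * (x 0 i * x 0 i))
      + sigma / 2 * frob_inner x x - frob_inner eta x.
  apply/funext => x; rewrite /spectral_objective frob_norm_pow4 frob_norm_sqr.
  congr (_ + _ * _ + _ - _); last by rewrite frob_innerE big_ord1.
  by apply: eq_bigr => i _; rewrite -!expr2 -exprM.
have cD (g1 g2 : 'rV[R]_r -> R) : continuous g1 -> continuous g2 ->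
    continuous (fun x => g1 x + g2 x).
  by move=> c1 c2 x; exact: (continuousD (c1 x) (c2 x)).
have cM (g1 g2 : 'rV[R]_r -> R) : continuous g1 -> continuous g2 ->
    continuous (fun x => g1 x * g2 x).
  by move=> c1 c2 x; exact: (continuousM (c1 x) (c2 x)).
have cc (c : R) : continuous (fun _ : 'rV[R]_r => c).
  by move=> x; exact: cst_continuous.
apply/cD; last by move=> x; apply: continuousN; apply: frob_inner_continuous.
apply/cD; last exact/cM/sqrc.
apply/cD; apply/cM => //; first exact/cM.
apply: continuous_big => [|i _]; first exact: add_continuous.
by apply/cM; apply/cM; exact: coordc.
Qed.

Hypothesis sigma_gt0 : 0 < sigma.

(** A minimizer exists because the sublevel set of [0], the value at the origin, is
closed and bounded.  The stationarity defect [G - diag_mx eta] at a minimizer is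
itself diagonal, so it is an admissible direction; being orthogonal to itself, it
vanishes. *)
Lemma spectral_objective_stationary eta : exists mu,
  diag_mx mu *m gram_multiplier alpha beta sigma (diag_sqr mu) = diag_mx eta.
Proof.
pose phi := spectral_objective alpha beta sigma eta.
have phi0 : phi 0 = 0.
  rewrite /phi /spectral_objective frob_norm_pow4 frob_norm_sqr frob_inner0l.
  rewrite !big1 => [|i _|i _]; rewrite ?mxE ?mulr0 ?expr0n //=.
  by rewrite !mulr0 !addr0 subrr.
have phi_ge x : sigma / 2 * frob_inner x x - frob_inner eta x <= phi x.
  have := tilted_linear_lower_bound sigma alpha_ge0 beta_ge0
    (diag_mx eta) (diag_mx 0) (diag_mx x).
  rewrite -!spectral_objectiveE -/phi phi0 -/(phi x) add0r linear0 mul0mx.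
  by rewrite add0r subr0 frob_innerNl !frob_inner_diag addrC.
have sublevel_bounded x : [set x | phi x <= 0] x ->
    frob_inner x x <= 4 / sigma ^+ 2 * frob_inner eta eta.
  move=> /= phix; have le0 := le_trans (phi_ge x) phix.
  have := frob_inner_ge0 (sigma *: x - 2 *: eta).
  rewrite !(frob_innerDl, frob_innerDr, frob_innerNl, frob_innerNr).
  rewrite !(frob_innerZl, frob_innerZr) (frob_innerC x eta) => sq_ge0.
  rewrite mulrAC ler_pdivlMr ?exprn_gt0 //.
  have := mulr_ge0_le0 (ltW sigma_gt0) le0; lra.
have phi_cont : continuous phi by exact: spectral_objective_continuous.
have sublevel_closed : closed [set x | phi x <= 0].
  apply: (@preimage_closed _ _ phi [set y | y <= 0]) => [x _|].
    exact: phi_cont.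
  exact: closed_le.
have [|mu mu0 mu_min] :=
    bounded_attains_min _ sublevel_closed sublevel_bounded phi_cont.
  by exists 0; rewrite /= phi0.
exists mu.
have mu_minT x : phi mu <= phi x.
  by have [/mu_min//|x_gt0] := leP (phi x) 0; exact: le_trans mu0 (ltW x_gt0).
rewrite -diag_mx_gram.
pose G := diag_mx mu
  *m gram_multiplier alpha beta sigma ((diag_mx mu)^T *m diag_mx mu).
have [g gE] : exists g : 'rV[R]_r, G - diag_mx eta = diag_mx g.
  exists (\row_i (mu 0 i * (alpha * \tr (diag_sqr mu) + beta * mu 0 i ^+ 2
                            + sigma) - eta 0 i)).
  rewrite /G diag_mx_gram; apply/matrixP => i j; rewrite mul_diag_mx !mxE.
  by case: eqVneq => [->|_]; rewrite ?mulr1n ?mulr0n; ring.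
apply/eqP; rewrite -subr_eq0 -/G gE; apply/eqP/frob_inner_eq0; rewrite -gE.
rewrite {2}gE; apply: (stationary_of_line_min (alpha := alpha)) => t.
by rewrite -linearZ -linearD -!spectral_objectiveE; exact: mu_minT.
Qed.

(** Stationarity among all matrices makes [diag_mx mu] the unique minimizer of the
tilted kernel, hence a fortiori among diagonal matrices. *)
Lemma spectral_objective_argmin eta mu :
  diag_mx mu *m gram_multiplier alpha beta sigma (diag_sqr mu) = diag_mx eta ->
  argmin (spectral_objective alpha beta sigma eta) = [set mu].
Proof.
move=> mu_stat.
pose tilt := tilted alpha beta sigma (diag_mx eta) : 'M[R]_r -> R.
have diag_argmin : argmin tilt = [set diag_mx mu].
  by apply: stationary_argmin => //; rewrite diag_mx_gram.
have diag_min U : tilt (diag_mx mu) <= tilt U.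
  by have : argmin tilt (diag_mx mu); [rewrite diag_argmin|exact].
apply/seteqP; split => x /= => [x_min | -> y]; last first.
  by rewrite !spectral_objectiveE; exact: diag_min.
have : argmin tilt (diag_mx x).
  move=> U; apply: le_trans (diag_min U).
  by rewrite /tilt -!spectral_objectiveE; exact: x_min.
rewrite diag_argmin /= => /matrixP xmu; apply/rowP => i.
by have := xmu i i; rewrite !mxE eqxx.
Qed.

Lemma gram_multiplier_diag_unit mu :
  gram_multiplier alpha beta sigma (diag_sqr mu) \in unitmx.
Proof.
have -> : gram_multiplier alpha beta sigma (diag_sqr mu)
    = diag_mx (\row_i (alpha * \tr (diag_sqr mu) + beta * mu 0 i ^+ 2 + sigma)).
  apply/matrixP => i j; rewrite !mxE.
  by case: eqVneq => _; rewrite ?mulr1n ?mulr0n; ring.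
rewrite unitmxE det_diag unitfE; apply/prodf_neq0 => i _; rewrite mxE gt_eqF //.
apply: ltr_wpDl => //; apply: addr_ge0; last by rewrite mulr_ge0 ?sqr_ge0.
rewrite mulr_ge0 // mxtrace_diag; apply: sumr_ge0 => j _.
by rewrite mxE sqr_ge0.
Qed.

End SpectralObjective.

(** * The closed form of the Bregman step *)

Unset Implicit Arguments.
Set Strict Implicit.

Theorem proposition2p4 (R : realType) (n r : nat)
    (F : 'M[R]_n -> R) (mu_F L_F alpha beta sigma lambda : R)
    (X : 'M[R]_(n, r)) :
  (1 <= n)%N -> (1 <= r <= n)%N ->
  0 <= mu_F -> mu_F <= L_F ->
  twice_continuously_differentiable F ->
  strongly_convex mu_F F ->
  smooth L_F F ->
  let f : 'M[R]_(n, r) -> R := factored F in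
  has_lbound (range f) ->
  0 <= alpha -> 0 <= beta -> 0 < sigma -> 0 < lambda ->
  let h : 'M[R]_(n, r) -> R := gram_kernel alpha beta sigma in
  let V : 'M[R]_(n, r) := gradient h X - lambda *: gradient f X in
  (exists (P : 'M[R]_r) (eta : 'rV[R]_r), diagonalizes (V^T *m V) P eta) /\
  (forall (P : 'M[R]_r) (eta : 'rV[R]_r), diagonalizes (V^T *m V) P eta ->
    let phi : 'rV[R]_r -> R := spectral_objective alpha beta sigma eta in
    convex_function [set: 'rV[R]_r] phi /\
    exists2 mu : 'rV[R]_r, argmin phi = [set mu] &
      let Z : 'M[R]_r := P^T *m diag_sqr mu *m P in
      let M : 'M[R]_r := (alpha * \tr Z)%:M + beta *: Z + sigma%:M in
      M \in unitmx /\ bregman_step f h lambda X = [set V *m invmx M]).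
Proof.
move=> _ _ _ _ _ _ _ f _ alpha_ge0 beta_ge0 sigma_gt0 lambda_gt0 h V.
split; first exact: gram_diagonalizable.
move=> P eta [PtP VE] phi.
have PPt : P *m P^T = 1%:M by exact: mulmx1C.
split; first by apply: spectral_objective_convex => //; exact: ltW.
have [mu mu_stat] :=
  spectral_objective_stationary alpha_ge0 beta_ge0 sigma_gt0 eta.
exists mu; first exact: spectral_objective_argmin.
move=> Z M; pose N := gram_multiplier alpha beta sigma (diag_sqr mu).
have trZ : \tr Z = \tr (diag_sqr mu).
  by rewrite /Z mxtrace_mulC mulmxA PPt mul1mx.
have ME : M = P^T *m N *m P.
  rewrite /M /N /gram_multiplier trZ !mulmxDr !mulmxDl -scalemxAr -scalemxAl.
  by rewrite !mul_mx_scalar -!scalemxAl PtP !scalemx1.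
have P_unit : P \in unitmx by case: (mulmx1_unit PPt).
have M_unit : M \in unitmx.
  rewrite ME !unitmx_mul unitmx_tr P_unit andbT /=.
  exact: gram_multiplier_diag_unit.
split=> //; rewrite bregman_step_argmin //.
apply: stationary_argmin => //.
(* [Q] is a square root of [Z], and [Q *m M] has the same Gram matrix as [V]. *)
pose Q := diag_mx mu *m P.
have ZE : Z = Q^T *m Q by rewrite /Z -diag_mx_gram /Q trmx_mul !mulmxA.
have QM : Q *m M = diag_mx eta *m P.
  by rewrite ME /Q -!mulmxA (mulmxA P) PPt mul1mx mulmxA mu_stat.
have MZM : M^T *m Z *m M = V^T *m V.
  rewrite ZE mulmxA -trmx_mul -mulmxA QM VE -diag_mx_gram.
  by rewrite trmx_mul !mulmxA.
have gramE : (V *m invmx M)^T *m (V *m invmx M) = Z.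
  rewrite trmx_mul mulmxA -(mulmxA _ V^T) -MZM trmx_inv !mulmxA.
  by rewrite mulVmx ?unitmx_tr // mul1mx mulmxK.
by rewrite gramE mulmxKV.
Qed.
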